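(* Let $A\in\mathbb{R}^{m\times n}$, $m\ge n$, have the SVD $A=U\begin{pmatrix}\Sigma\\ \mathbf{0}\end{pmatrix}V^T$ with $U,V$ orthogonal, $V=(v_1,\dots,v_n)$, $\Sigma=\mathrm{diag}(\sigma_1,\dots,\sigma_n)$ and $\sigma_1>\sigma_2>\cdots>\sigma_n>0$, let $b\in\mathbb{R}^m$, and assume that Lanczos bidiagonalization of $A$ started with $b$ does not break down. For $k=1,2,\ldots,n-1$, let $\mathcal{V}_k=\mathrm{span}\{v_1,\dots,v_k\}$, let $V_k^{\perp}=(v_{k+1},\dots,v_n)$ be the matrix consisting of the last $n-k$ columns of $V$, and let $\mathcal{V}_k^R=\mathrm{span}\{A^Tb,(A^TA)A^Tb,\dots,(A^TA)^{k-1}A^Tb\}$. Let $\|\sin\Theta(\mathcal{V}_k,\mathcal{V}_k^R)\|^2=1-\varepsilon_k^2$ with $0<\varepsilon_k<1$, and let the unit-length $\tilde q_k\in\mathcal{V}_k^R$ be the vector that has the smallest angle with $\mathrm{span}\{V_k^{\perp}\}$, i.e., the closest to $\mathrm{span}\{V_k^{\perp}\}$. Then $$\varepsilon_k^2\sigma_k^2+(1-\varepsilon_k^2)\sigma_n^2<\tilde q_k^TA^TA\tilde q_k<\varepsilon_k^2\sigma_1^2+(1-\varepsilon_k^2)\sigma_{k+1}^2.$$ If $\varepsilon_k\geq\frac{\sigma_{k+1}}{\sigma_k}$, then $$\sqrt{\tilde q_k^TA^TA\tilde q_k}>\sigma_{k+1}.$$ If $\varepsilon_k^2\leq\dfrac{\delta}{\left(\frac{\sigma_1}{\sigma_{k+1}}\right)^2-1}$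 for a given arbitrarily small $\delta>0$, then $$\theta_k^{(k)}<(1+\delta)^{1/2}\sigma_{k+1},$$ meaning that $\theta_k^{(k)}<\sigma_{k+1}$ once $\varepsilon_k$ is sufficiently small, i.e., once $\|\sin\Theta(\mathcal{V}_k,\mathcal{V}_k^R)\|$ is sufficiently close to one.
   Context: $\|\cdot\|$ is the 2-norm of a vector or the spectral norm of a matrix. $\Theta(\mathcal{X},\mathcal{Y})$ denotes the canonical angles between two subspaces of equal dimension; if the columns of $Q_k\in\mathbb{R}^{n\times k}$ form an orthonormal basis of $\mathcal{V}_k^R$, then $\|\sin\Theta(\mathcal{V}_k,\mathcal{V}_k^R)\|=\|(V_k^{\perp})^TQ_k\|$. That $\tilde q_k$ is a unit vector in $\mathcal{V}_k^R$ closest to $\mathrm{span}\{V_k^\perp\}$ (the span of the columns of $V_k^\perp$) means $\|(V_k^\perp)^T\tilde q_k\|=\max_{q\in\mathcal{V}_k^R,\|q\|=1}\|(V_k^\perp)^Tq\|$. Lanczos bidiagonalization: $p_1=b/\|b\|$, $\beta_1=\|b\|$, $q_0=\mathbf{0}$, and for $j=1,2,\dots,k$: $r=A^Tp_j-\beta_jq_{j-1}$, $\alpha_j=\|r\|$, $q_j=r/\alpha_j$, $z=Aq_j-\alpha_jp_j$, $\beta_{j+1}=\|z\|$, $p_{j+1}=z/\beta_{j+1}$; no breakdown means $\alpha_j>0$ and $\beta_{j+1}>0$ for $j=1,\dots,k$. Then $Q_k=(q_1,\dots,q_k)$ has orthonormal columns spanning $\mathcal{V}_k^R$, $P_{k+1}=(p_1,\dots,p_{k+1})$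 has orthonormal columns, and $AQ_k=P_{k+1}B_k$, where $B_k=P_{k+1}^TAQ_k\in\mathbb{R}^{(k+1)\times k}$ is lower bidiagonal with diagonal $\alpha_1,\dots,\alpha_k$ and subdiagonal $\beta_2,\dots,\beta_{k+1}$. The singular values $\theta_1^{(k)}>\theta_2^{(k)}>\cdots>\theta_k^{(k)}$ of $B_k$ are called the Ritz values of $A$ with respect to the left and right subspaces spanned by the columns of $P_{k+1}$ and $Q_k$; $\theta_k^{(k)}$ is the smallest one.
   Formalization: For k=1 when Lanczos stops before q_3 (α_3=0, always so if n=2), where equality can occur, both bounds on q̃_k^T A^T A q̃_k and the bound on θ_k^{(k)} are stated with ≤; the closing gloss θ_k^{(k)}<σ_{k+1} for small ε_k, false for k=n−1, is left out. *)

(* Defs.v *)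
From mathcomp Require Import all_boot all_order all_algebra.
From mathcomp Require Import all_classical all_reals all_analysis.

Set Implicit Arguments.
Unset Strict Implicit.
Unset Printing Implicit Defensive.

Import Order.TTheory GRing.Theory Num.Theory.

Local Open Scope ring_scope.
Local Open Scope classical_set_scope.

(* Families that are numbered from 1 in the mathematics (singular values,
   canonical angles, Lanczos vectors and coefficients) are functions on nat
   indexed from 1; their values at irrelevant indices are unconstrained.
   Columns and rows of matrices are indexed by ordinals, hence from 0. *)

Section Norms.
Variable R : realType.

(* MathComp-Analysis equips matrices with the max norm, so the Euclidean and
   spectral norms are defined here. *)
Definition norm2 (n : nat) (x : 'cV[R]_n) : R :=
  Num.sqrt (\sum_(i < n) x i 0 ^+ 2).

(* Meaningful for p > 0; for p = 0 there is no unit vector. *)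
Definition spectral_norm (n p : nat) (M : 'M[R]_(n, p)) : R :=
  sup [set norm2 (M *m x) | x in [set x | norm2 x = 1]].

End Norms.

Section SVD.
Variable R : realType.

(* The rectangular matrix with s 1, s 2, ... on its main diagonal; for
   n <= m it is diag(s 1, ..., s n) above an (m - n) x n zero block. *)
Definition rect_diag (m n : nat) (s : nat -> R) : 'M[R]_(m, n) :=
  \matrix_(i < m, j < n) (if i == j :> nat then s j.+1 else 0).

Definition is_svd (m n : nat) (A : 'M[R]_(m, n)) (U : 'M[R]_m)
    (s : nat -> R) (V : 'M[R]_n) : Prop :=
  [/\ U^T *m U = 1%:M, V^T *m V = 1%:M,
      A = U *m rect_diag m n s *m V^T,
      (forall i, (0 < i <= minn m n)%N -> 0 <= s i)
    & (forall i, (0 < i < minn m n)%N -> s i.+1 <= s i)].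

Definition singular_values (m n : nat) (A : 'M[R]_(m, n)) (s : nat -> R) :
    Prop :=
  exists U V, is_svd A U s V.

End SVD.

Section Subspaces.
Variable R : realType.

Definition colspan (n k : nat) (M : 'M[R]_(n, k)) : {vspace 'cV[R]_n} :=
  <<[seq col j M | j <- enum 'I_k]>>%VS.

Definition orthonormal_basis (n k : nat) (X : 'M[R]_(n, k))
    (W : {vspace 'cV[R]_n}) : Prop :=
  X^T *m X = 1%:M /\ colspan X = W.

(* Theta 1 <= ... <= Theta k are the canonical angles between the
   k-dimensional subspaces W1 and W2: their cosines are the singular values of
   X^T Y for orthonormal bases X of W1 and Y of W2. *)
Definition canonical_angles (n k : nat) (W1 W2 : {vspace 'cV[R]_n})
    (Theta : nat -> R) : Prop :=
  (forall i, (0 < i <= k)%N -> 0 <= Theta i <= pi / 2) /\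
  exists X Y : 'M[R]_(n, k),
    [/\ orthonormal_basis X W1, orthonormal_basis Y W2
      & singular_values (X^T *m Y) (fun i => cos (Theta i))].

Definition sin_diag (k : nat) (Theta : nat -> R) : 'M[R]_k :=
  diag_mx (\row_(i < k) sin (Theta i.+1)).

Definition first_cols (n k : nat) (hk : (k <= n)%N) (V : 'M[R]_n) :
    'M[R]_(n, k) :=
  colsub (widen_ord hk) V.

Definition last_cols (n k : nat) (hk : (k <= n)%N) (V : 'M[R]_n) :
    'M[R]_(n, n - k) :=
  colsub (fun j => cast_ord (subnKC hk) (rshift k j)) V.

Definition krylov (m n : nat) (A : 'M[R]_(m, n)) (b : 'cV[R]_m) (k : nat) :
    {vspace 'cV[R]_n} :=
  <<[seq (A^T *m A) ^+ j *m (A^T *m b) | j <- iota 0 k]>>%VS.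

Definition quad_form (m n : nat) (A : 'M[R]_(m, n)) (q : 'cV[R]_n) : R :=
  (q^T *m A^T *m A *m q) 0 0.

Definition closest_unit_vector (n l : nat) (W : {vspace 'cV[R]_n})
    (Vp : 'M[R]_(n, l)) (q : 'cV[R]_n) : Prop :=
  [/\ q \in W, norm2 q = 1
    & forall x, x \in W -> norm2 x = 1 ->
        norm2 (Vp^T *m x) <= norm2 (Vp^T *m q)].

End Subspaces.

Section Lanczos.
Variables (R : realType) (m n : nat) (A : 'M[R]_(m, n)) (b : 'cV[R]_m).

(* State j is (p_(j+1), beta_(j+1), q_j).  A zero divisor (a breakdown) makes
   the corresponding vector zero, because 0^-1 = 0. *)
Fixpoint lanczos_state (j : nat) : 'cV[R]_m * R * 'cV[R]_n :=
  match j with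
  | 0 => ((norm2 b)^-1 *: b, norm2 b, 0)
  | j'.+1 =>
      let: (p, beta, q) := lanczos_state j' in
      let r := A^T *m p - beta *: q in
      let alpha := norm2 r in
      let q' := alpha^-1 *: r in
      let z := A *m q' - alpha *: p in
      ((norm2 z)^-1 *: z, norm2 z, q')
  end.

Definition lanczos_p (j : nat) : 'cV[R]_m := (lanczos_state j.-1).1.1.
Definition lanczos_beta (j : nat) : R := (lanczos_state j.-1).1.2.
Definition lanczos_q (j : nat) : 'cV[R]_n := (lanczos_state j).2.
Definition lanczos_alpha (j : nat) : R :=
  norm2 (A^T *m lanczos_p j - lanczos_beta j *: lanczos_q j.-1).

Definition no_breakdown (k : nat) : Prop :=
  forall j, (0 < j <= k)%N -> 0 < lanczos_alpha j /\ 0 < lanczos_beta j.+1.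

Definition lanczos_Q (k : nat) : 'M[R]_(n, k) :=
  \matrix_(i < n, j < k) lanczos_q j.+1 i 0.

Definition lanczos_P (k : nat) : 'M[R]_(m, k) :=
  \matrix_(i < m, j < k) lanczos_p j.+1 i 0.

Definition lanczos_B (k : nat) : 'M[R]_(k.+1, k) :=
  (lanczos_P k.+1)^T *m A *m lanczos_Q k.

Definition ritz_values (k : nat) (theta : nat -> R) : Prop :=
  singular_values (lanczos_B k) theta.

(* The boundary case k = 1 in which the recurrence stops before producing q_3
   (always so when n = 2).  Then A^T b may lie in a span of two right singular
   vectors, such as <v_1, v_2>, and the estimates can be equalities. *)
Definition terminal_first_step (k : nat) : bool :=
  (k == 1) && (lanczos_alpha 3 == 0).

End Lanczos.

(* Main.v *)
Require Import Defs.
From mathcomp Require Import all_boot all_order all_algebra.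
From mathcomp Require Import all_classical all_reals all_analysis.
From mathcomp Require Import ring lra.
Import Order.TTheory GRing.Theory Num.Theory.
Local Open Scope ring_scope.

Set Implicit Arguments.
Unset Strict Implicit.
Unset Printing Implicit Defensive.

(** Write [y = V^T q] for the coordinates of [q] in the right singular vectors,
    so that [quad_form A q] is the sum of the [sigma_i^2 y_i^2]
    ([svd_quad_form]).  The cosines of the canonical angles are the singular
    values of [X^T Y], hence the least of them is the least length of the
    projection of a unit vector of the Krylov space [W] onto the span of the
    first [k] singular vectors ([min_cos_le], [min_cos_attained]).  This least
    cosine is [eps] ([spectral_norm_sin_diag]), and the vector closest to the
    span of the last singular vectors is the one that attains it: the first [k]
    squared coordinates of [q] add up to [eps^2], the others to [1 - eps^2].
    Bounding [sigma_i] in each of the two clusters by its extreme values gives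
    both estimates with non-strict inequalities ([two_cluster_bound]).

    Equality would force [y] to be supported on two indices [a <= k < c].  But
    [q] minimizes [|F^T w|^2] over the unit vectors [w] of [W], where [F] is the
    matrix of the first [k] singular vectors, so it satisfies a first-order
    condition ([stationary]).  If [k >= 2] this condition, tested against
    [A^T b] and [A^T A A^T b], annihilates the component of [W] along [v_a],
    which contradicts [y_a^2 = eps^2 > 0].  If [k = 1] then [A^T b] itself is a
    combination of [v_a] and [v_c], and the Lanczos process cannot produce a
    third orthonormal vector in their span, that is, [alpha_3 = 0]
    ([two_sparse_minimizer_terminal], [lanczos_stops]).

    The comparison with [sigma_(k+1)] follows from the lower estimate, in which
    the term with [sigma_n] is positive.  For the Ritz value, [W] is contained
    in the span of the orthonormal columns of [Q_k] ([krylov_sub_lanczos]), so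
    [q = Q_k x] with [x] a unit vector, and
    [theta_k <= |B_k x| = |P_(k+1)^T A q| <= |A q|] by the minimality of
    [theta_k] and Bessel's inequality.  The upper estimate bounds [|A q|]. *)

(** * Euclidean inner product *)

Section InnerProduct.
Variable R : realType.

Definition dotv (n : nat) (x y : 'cV[R]_n) : R := (x^T *m y) 0 0.

Lemma dotvE n (x y : 'cV[R]_n) : dotv x y = \sum_i x i 0 * y i 0.
Proof. by rewrite /dotv mxE; apply: eq_bigr => i _; rewrite mxE. Qed.

Lemma dotvC n (x y : 'cV[R]_n) : dotv x y = dotv y x.
Proof. by rewrite !dotvE; apply: eq_bigr => i _; rewrite mulrC. Qed.

Lemma dotvDr n (x y z : 'cV[R]_n) : dotv x (y + z) = dotv x y + dotv x z.
Proof. by rewrite /dotv mulmxDr mxE. Qed.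

Lemma dotvBr n (x y z : 'cV[R]_n) : dotv x (y - z) = dotv x y - dotv x z.
Proof. by rewrite /dotv mulmxBr !mxE. Qed.

Lemma dotvZr n a (x y : 'cV[R]_n) : dotv x (a *: y) = a * dotv x y.
Proof. by rewrite /dotv -scalemxAr mxE. Qed.

Lemma dotvDl n (x y z : 'cV[R]_n) : dotv (x + y) z = dotv x z + dotv y z.
Proof. by rewrite dotvC dotvDr !(dotvC z). Qed.

Lemma dotvBl n (x y z : 'cV[R]_n) : dotv (x - y) z = dotv x z - dotv y z.
Proof. by rewrite dotvC dotvBr !(dotvC z). Qed.

Lemma dotvZl n a (x y : 'cV[R]_n) : dotv (a *: x) y = a * dotv x y.
Proof. by rewrite dotvC dotvZr dotvC. Qed.

Lemma dotv0 n (x : 'cV[R]_n) : dotv x 0 = 0.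
Proof. by rewrite /dotv mulmx0 mxE. Qed.

Lemma dotv_adj m n (M : 'M[R]_(m, n)) x y : dotv (M *m x) y = dotv x (M^T *m y).
Proof. by rewrite /dotv trmx_mul mulmxA. Qed.

Lemma dotv_sqr n (x : 'cV[R]_n) : dotv x x = \sum_i x i 0 ^+ 2.
Proof. by rewrite dotvE; apply: eq_bigr => i _; rewrite expr2. Qed.

Lemma dotv_ge0 n (x : 'cV[R]_n) : 0 <= dotv x x.
Proof. by rewrite dotv_sqr sumr_ge0 // => i _; rewrite sqr_ge0. Qed.

Lemma sqr_norm2 n (x : 'cV[R]_n) : norm2 x ^+ 2 = dotv x x.
Proof. by rewrite /norm2 -dotv_sqr sqr_sqrtr // dotv_ge0. Qed.

Lemma norm2_ge0 n (x : 'cV[R]_n) : 0 <= norm2 x.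
Proof. exact: sqrtr_ge0. Qed.

Lemma norm2_eq0 n (x : 'cV[R]_n) : norm2 x = 0 -> x = 0.
Proof.
move=> x0; have := sqr_norm2 x; rewrite x0 expr0n /= dotv_sqr => /esym/eqP.
rewrite psumr_eq0 => [/allP h|i _]; last exact: sqr_ge0.
apply/colP => i; rewrite mxE; apply/eqP; rewrite -sqrf_eq0.
by apply: h; rewrite mem_index_enum.
Qed.

Lemma norm2_0 n : norm2 (0 : 'cV[R]_n) = 0.
Proof. by apply/eqP; rewrite -sqrf_eq0 sqr_norm2 dotv0. Qed.

Lemma norm2_eq1 n (x : 'cV[R]_n) : (norm2 x = 1) <-> (dotv x x = 1).
Proof.
rewrite -sqr_norm2; split=> [->|/eqP]; first by rewrite expr1n.
rewrite sqrf_eq1 => /orP[/eqP//|/eqP x1].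
by have := norm2_ge0 x; rewrite x1 ler0N1.
Qed.

Lemma norm2_normalized n (x : 'cV[R]_n) :
  norm2 x *: ((norm2 x)^-1 *: x) = x.
Proof.
have [x0|x0] := eqVneq (norm2 x) 0; last by rewrite scalerA divff // scale1r.
by rewrite (norm2_eq0 x0) !scaler0.
Qed.

Lemma dotv_normalized n (x : 'cV[R]_n) : norm2 x != 0 ->
  dotv ((norm2 x)^-1 *: x) ((norm2 x)^-1 *: x) = 1.
Proof.
by move=> x0; rewrite dotvZl dotvZr -sqr_norm2 expr2 mulKf // mulVf.
Qed.

Lemma dotv_isometry m n (M : 'M[R]_(m, n)) x y :
  M^T *m M = 1%:M -> dotv (M *m x) (M *m y) = dotv x y.
Proof. by move=> MM; rewrite dotv_adj mulmxA MM mul1mx. Qed.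

(** The residual of the orthogonal projection has nonnegative square length. *)
Lemma bessel m n (M : 'M[R]_(m, n)) x :
  M^T *m M = 1%:M -> dotv (M^T *m x) (M^T *m x) <= dotv x x.
Proof.
move=> MM; have := dotv_ge0 (x - M *m (M^T *m x)).
rewrite dotvBl !dotvBr dotv_isometry // (dotvC x) dotv_adj; lra.
Qed.

Lemma dotv_delta n (i : 'I_n) :
  dotv (delta_mx i 0) (delta_mx i 0 : 'cV[R]_n) = 1.
Proof. by rewrite /dotv trmx_delta -rowE !mxE !eqxx. Qed.

Lemma col_mulmx m n k (M : 'M[R]_(m, n)) (N : 'M[R]_(n, k)) j :
  col j (M *m N) = M *m col j N.
Proof. by rewrite !colE mulmxA. Qed.

(** Both traces of [Z^T Z] and [Z Z^T] count: the first is the number of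
    orthonormal columns, and each of the #|I| nonzero diagonal entries of the
    second is at most 1 by Bessel's inequality. *)
Lemma orthonormal_support n k (Z : 'M[R]_(n, k)) (I : {set 'I_n}) :
  Z^T *m Z = 1%:M -> (forall i j, i \notin I -> Z i j = 0) -> (k <= #|I|)%N.
Proof.
move=> ZZ ZI; rewrite -(ler_nat R) -(mxtrace1 R k) -ZZ mxtrace_mulC /mxtrace.
rewrite (bigID (mem I)) /= [X in _ + X]big1 ?addr0; last first.
  by move=> i iI; rewrite mxE big1 // => j _; rewrite ZI // mul0r.
rewrite -sum1_card natr_sum; apply: ler_sum => i _.
rewrite mxE -(dotv_delta i); apply: le_trans (bessel _ ZZ); rewrite -colE dotvE.
by rewrite ler_sum // => j _; rewrite !mxE.
Qed.

End InnerProduct.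

(** * Membership in spans *)

Section Spans.

(** Induction over a span, for properties that are not given as subspaces. *)
Lemma span_ind (K : fieldType) (vT : vectType K) (X : seq vT)
    (P : vT -> Prop) :
  P 0 -> (forall a u v, P u -> P v -> P (a *: u + v)) ->
  {in X, forall x, P x} -> {in <<X>>%VS, forall x, P x}.
Proof.
move=> P0 PL PX x; rewrite -[X]/(tval (in_tuple X)) => /coord_span ->.
elim/big_rec: _ => // i y _ Py; apply: PL => //.
by apply: PX; rewrite mem_nth.
Qed.

Variable R : realType.

Lemma colspanP n k (M : 'M[R]_(n, k)) x :
  (x \in colspan M) <-> exists c, x = M *m c.
Proof.
split.
  move: x; apply: span_ind.
  - by exists 0; rewrite mulmx0.
  - by move=> a _ _ [c ->] [d ->]; exists (a *: c + d);
    rewrite mulmxDr scalemxAr.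
  - by move=> _ /mapP[j _ ->]; exists (delta_mx j 0); rewrite -colE.
move=> [c ->]; have -> : M *m c = \sum_j c j 0 *: col j M.
  by apply/colP => i; rewrite mxE summxE; apply: eq_bigr => j _;
    rewrite !mxE mulrC.
apply: memv_suml => j _.
by apply/memvZ/memv_span/map_f; rewrite mem_enum.
Qed.

(** The orthogonal projector onto a subspace does not depend on the basis: the
    two bases differ by a square matrix [C] with [C^T C = 1], hence
    [C C^T = 1]. *)
Lemma orthonormal_basis_proj n k (X Y : 'M[R]_(n, k)) W :
  orthonormal_basis X W -> orthonormal_basis Y W -> X *m X^T = Y *m Y^T.
Proof.
move=> [XX XW] [YY YW].
have YX : Y *m (Y^T *m X) = X.
  apply/matrixP => i j; suff /colP/(_ i) : col j (Y *m (Y^T *m X)) = col j X.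
    by rewrite !mxE.
  have [|c jc] := (colspanP Y (col j X)).1.
    by rewrite YW -XW; apply/colspanP; exists (delta_mx j 0); rewrite -colE.
  by rewrite colE -!mulmxA -colE jc (mulmxA Y^T) YY mul1mx.
move: YX; move: (Y^T *m X) => C YX.
have CC : C^T *m C = 1%:M.
  by rewrite -XX -YX trmx_mul -mulmxA (mulmxA Y^T) YY mul1mx.
by rewrite -YX trmx_mul mulmxA -(mulmxA Y) (mulmx1C CC) mulmx1.
Qed.

End Spans.

(** * Quadratic forms and singular values *)

Section SingularValues.
Variable R : realType.

Lemma quad_form_dotv m n (A : 'M[R]_(m, n)) x :
  quad_form A x = dotv (A *m x) (A *m x).
Proof. by rewrite /quad_form /dotv trmx_mul !mulmxA. Qed.

(** [U] cancels in [A^T A], so the right singular vectors diagonalize it. *)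
Lemma svd_gram m n (A : 'M[R]_(m, n)) U s V i (x : 'cV[R]_n) : (n <= m)%N ->
  is_svd A U s V ->
  (V^T *m (A^T *m A *m x)) i 0 = s i.+1 ^+ 2 * (V^T *m x) i 0.
Proof.
move=> nm [UU VV -> _ _].
have -> : V^T *m ((U *m rect_diag m n s *m V^T)^T
      *m (U *m rect_diag m n s *m V^T) *m x)
    = (rect_diag m n s)^T *m rect_diag m n s *m (V^T *m x).
  rewrite !trmx_mul trmxK !mulmxA VV mul1mx.
  by rewrite -(mulmxA _ U^T) UU mulmx1.
have -> : (rect_diag m n s)^T *m rect_diag m n s
    = diag_mx (\row_j s j.+1 ^+ 2).
  apply/matrixP => j l; rewrite !mxE (bigD1 (widen_ord nm j)) //= !mxE eqxx.
  rewrite big1 ?addr0 => [|r rj].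
    by rewrite -val_eqE /=; case: eqP => [->|_]; rewrite ?mulr0 ?mulr0n ?mulr1n.
  by rewrite !mxE -[_ == _ :> nat]/(r == widen_ord nm j) (negPf rj) mul0r.
by rewrite mul_diag_mx !mxE.
Qed.

Lemma svd_quad_form m n (A : 'M[R]_(m, n)) U s V x : (n <= m)%N ->
  is_svd A U s V ->
  quad_form A x = \sum_(i < n) s i.+1 ^+ 2 * (V^T *m x) i 0 ^+ 2.
Proof.
move=> nm svd; have [_ VV _ _ _] := svd.
have VV' : V^T^T *m V^T = 1%:M by rewrite trmxK (mulmx1C VV).
have -> : quad_form A x = dotv x (A^T *m A *m x).
  by rewrite /quad_form /dotv !mulmxA.
rewrite -(dotv_isometry _ _ VV') dotvE; apply: eq_bigr => i _.
by rewrite (svd_gram _ _ nm svd); ring.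
Qed.

Lemma nonincreasing_from1 n (s : nat -> R) i j :
  (forall i, (0 < i < n)%N -> s i.+1 <= s i) ->
  (0 < i)%N -> (i <= j <= n)%N -> s j <= s i.
Proof.
move=> dec i0; elim: j => [|j IH].
  by case: i i0 => // i _ /=.
rewrite leq_eqVlt => /andP[/orP[/eqP->//|ij] jn].
apply: le_trans (IH _); last by rewrite -ltnS ij ltnW.
by apply: dec; rewrite jn andbT (leq_trans i0).
Qed.

Lemma decreasing_from1 n (s : nat -> R) i j :
  (forall i, (0 < i < n)%N -> s i.+1 < s i) ->
  (0 < i)%N -> (i < j <= n)%N -> s j < s i.
Proof.
move=> dec i0 /andP[ij jn]; have le1 l : (0 < l < n)%N -> s l.+1 <= s l.
  by move=> /dec /ltW.
apply: le_lt_trans (nonincreasing_from1 le1 _ _) (dec i _); rewrite ?ij ?jn //.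
by rewrite i0 (leq_trans ij).
Qed.

(** With the next lemma, the Courant-Fischer characterization of the smallest
    singular value: [t k] is the minimum of the stretching of [M]. *)
Lemma min_singular_value_le m k (M : 'M[R]_(m, k)) t x :
  (0 < k <= m)%N -> singular_values M t ->
  t k ^+ 2 * dotv x x <= quad_form M x.
Proof.
move=> /andP[k0 km] [U [V svd]]; have [_ VV _ t0 dec] := svd.
move: t0 dec; rewrite (minn_idPr km) => t0 dec.
have VV' : V^T^T *m V^T = 1%:M by rewrite trmxK (mulmx1C VV).
rewrite (svd_quad_form _ km svd) -(dotv_isometry _ _ VV') dotv_sqr mulr_sumr.
apply: ler_sum => i _; apply: ler_wpM2r; first exact: sqr_ge0.
have ti0 : 0 <= t k by apply: t0; rewrite k0 leqnn.
rewrite ler_sqr ?nnegrE //; last by apply: t0; rewrite ltn_ord.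
apply: (nonincreasing_from1 dec) => //; by rewrite ltn_ord leqnn.
Qed.

Lemma min_singular_value_attained m k (M : 'M[R]_(m, k)) t :
  (0 < k <= m)%N -> singular_values M t ->
  exists2 x, dotv x x = 1 & quad_form M x = t k ^+ 2.
Proof.
move=> /andP[k0 km] [U [V svd]]; have [_ VV _ _ _] := svd.
have kk : (k.-1 < k)%N by rewrite prednK.
pose e : 'cV[R]_k := delta_mx (Ordinal kk) 0.
exists (V *m e).
  by rewrite dotv_isometry // dotv_delta.
rewrite (svd_quad_form _ km svd) mulmxA VV mul1mx (bigD1 (Ordinal kk)) //= big1.
  by rewrite mxE !eqxx expr1n addr0 mulr1 prednK.
by move=> i ik; rewrite mxE (negPf ik) expr0n mulr0.
Qed.

End SingularValues.

(** * Lanczos bidiagonalization *)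

Section Lanczos.
Variables (R : realType) (m n : nat) (A : 'M[R]_(m, n)) (b : 'cV[R]_m).
Local Notation p := (lanczos_p A b).
Local Notation q := (lanczos_q A b).
Local Notation al := (lanczos_alpha A b).
Local Notation be := (lanczos_beta A b).

Lemma lanczos_qS i : q i.+1
  = (al i.+1)^-1 *: (A^T *m p i.+1 - be i.+1 *: q i).
Proof.
rewrite /lanczos_alpha /lanczos_p /lanczos_beta /lanczos_q /=.
by case: (lanczos_state A b i) => [[? ?] ?].
Qed.

Lemma lanczos_betaS i : be i.+2 = norm2 (A *m q i.+1 - al i.+1 *: p i.+1).
Proof.
rewrite /lanczos_alpha /lanczos_p /lanczos_beta /lanczos_q /=.
by case: (lanczos_state A b i) => [[? ?] ?].
Qed.

Lemma lanczos_pS i : p i.+2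
  = (be i.+2)^-1 *: (A *m q i.+1 - al i.+1 *: p i.+1).
Proof.
rewrite /lanczos_alpha /lanczos_p /lanczos_beta /lanczos_q /=.
by case: (lanczos_state A b i) => [[? ?] ?].
Qed.

Lemma lanczos_q0 : q 0 = 0. Proof. by []. Qed.

Lemma lanczos_p1 : be 1 *: p 1 = b.
Proof. exact: norm2_normalized. Qed.

(** At a breakdown the residual is zero, and so is the vector obtained from it
    by normalization, so the recurrences survive. *)
Lemma lanczos_recq i : A^T *m p i.+1 = al i.+1 *: q i.+1 + be i.+1 *: q i.
Proof. by rewrite lanczos_qS norm2_normalized subrK. Qed.

Lemma lanczos_recp i : A *m q i.+1 = be i.+2 *: p i.+2 + al i.+1 *: p i.+1.
Proof. by rewrite lanczos_pS lanczos_betaS norm2_normalized subrK. Qed.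

Lemma lanczos_q_unit i : al i.+1 != 0 -> dotv (q i.+1) (q i.+1) = 1.
Proof. by move=> ?; rewrite lanczos_qS dotv_normalized. Qed.

Lemma lanczos_p_unit i : be i.+1 != 0 -> dotv (p i.+1) (p i.+1) = 1.
Proof.
case: i => [|i] b0; first exact: dotv_normalized.
by rewrite lanczos_pS lanczos_betaS dotv_normalized // -lanczos_betaS.
Qed.

(** A breakdown is final: here and in the next lemma, a vanishing coefficient
    makes the vector that it normalizes, and with it the next coefficient,
    vanish. *)
Lemma lanczos_beta0_alpha0 i : be i.+1 = 0 -> al i.+1 = 0.
Proof.
move=> b0; have p0 : p i.+1 = 0.
  case: i b0 => [|i] b0; first by rewrite /lanczos_p /= (norm2_eq0 b0) scaler0.
  by rewrite lanczos_pS b0 invr0 scale0r.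
by rewrite /lanczos_alpha p0 b0 mulmx0 scale0r subr0 norm2_0.
Qed.

Lemma lanczos_alpha0_beta0 i : al i.+1 = 0 -> be i.+2 = 0.
Proof.
move=> a0; have q0 : q i.+1 = 0 by rewrite lanczos_qS a0 invr0 scale0r.
by rewrite lanczos_betaS q0 a0 mulmx0 scale0r subr0 norm2_0.
Qed.

(** A Lanczos vector has square length 1 before a breakdown and 0 from then
    on.  Since a breakdown is final, a coefficient absorbs the square lengths
    of all the vectors computed up to it; these four identities replace unit
    length in the orthogonality argument and make it unconditional. *)
Lemma mul_alpha_dotv_q i : al i.+1 * dotv (q i.+1) (q i.+1) = al i.+1.
Proof.
have [->|a0] := eqVneq (al i.+1) 0; first by rewrite mul0r.
by rewrite lanczos_q_unit // mulr1.
Qed.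

Lemma mul_alpha_dotv_p i : al i.+1 * dotv (p i.+1) (p i.+1) = al i.+1.
Proof.
have [b0|b0] := eqVneq (be i.+1) 0.
  by rewrite (lanczos_beta0_alpha0 b0) mul0r.
by rewrite lanczos_p_unit // mulr1.
Qed.

Lemma mul_beta_dotv_p i : be i.+1 * dotv (p i.+1) (p i.+1) = be i.+1.
Proof.
have [->|b0] := eqVneq (be i.+1) 0; first by rewrite mul0r.
by rewrite lanczos_p_unit // mulr1.
Qed.

Lemma mul_beta_dotv_q i : be i.+2 * dotv (q i.+1) (q i.+1) = be i.+2.
Proof.
have [a0|a0] := eqVneq (al i.+1) 0.
  by rewrite (lanczos_alpha0_beta0 a0) mul0r.
by rewrite lanczos_q_unit // mulr1.
Qed.

(** The classical argument: moving [A] across the inner product with one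
    recurrence and expanding with the other leaves only inner products that
    are known, and the two terms that survive for neighbouring indices
    cancel.  After a breakdown the vectors are zero and orthogonality is
    trivial. *)
Lemma lanczos_orthogonal j l i : (i < l <= j)%N ->
  dotv (p i.+1) (p l.+1) = 0 /\ dotv (q i.+1) (q l.+1) = 0.
Proof.
elim: j l i => [|j IH] l i; first by case: l => [|l] /andP[].
move=> /andP[il]; rewrite leq_eqVlt => /orP[lj|lj]; last first.
  by apply: IH; rewrite il.
move: lj il => /eqP -> ij {l}.
have qj r : (r <= j)%N -> dotv (q r) (q j.+1) = 0.
  case: r => [_|r rj]; first by rewrite dotvC dotv0.
  by have [|//] := IH j r; rewrite rj /=.
have pj r : (r < j)%N -> dotv (p r.+1) (p j.+1) = 0.
  by move=> rj; have [|//] := IH j r; rewrite rj /=.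
have pp r : (r <= j)%N -> dotv (p r.+1) (p j.+2) = 0.
  move=> rj; rewrite (lanczos_pS j) dotvZr dotvBr dotvZr.
  rewrite dotvC dotv_adj lanczos_recq dotvDr !dotvZr !(dotvC (q j.+1)).
  rewrite (qj r) // mulr0 addr0.
  have [->|rj'] := eqVneq r j.
    by rewrite mul_alpha_dotv_q mul_alpha_dotv_p subrr mulr0.
  have {}rj : (r < j)%N by rewrite ltn_neqAle rj' rj.
  by rewrite qj // pj // !mulr0 subrr mulr0.
split; first exact: pp.
rewrite (lanczos_qS j.+1) dotvZr dotvBr dotvZr -dotv_adj lanczos_recp.
rewrite dotvDl !dotvZl.
rewrite (pp i) // mulr0 addr0.
have [->|ij'] := eqVneq i j.
  by rewrite mul_beta_dotv_p mul_beta_dotv_q subrr mulr0.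
have {}ij : (i < j)%N by rewrite ltn_neqAle ij' -ltnS.
by rewrite pp // qj // !mulr0 subrr mulr0.
Qed.

Lemma lanczos_P_orthonormal k : (forall i, (i < k)%N -> be i.+1 != 0) ->
  (lanczos_P A b k)^T *m lanczos_P A b k = 1%:M.
Proof.
move=> b0; apply/matrixP => i j; rewrite !mxE.
transitivity (dotv (p i.+1) (p j.+1)).
  by rewrite dotvE; apply: eq_bigr => r _; rewrite !mxE.
rewrite -val_eqE /=; have [ij|ij|->] := ltngtP i j.
- by have [|//] := @lanczos_orthogonal j j i; rewrite ij /=.
- by rewrite dotvC; have [|//] := @lanczos_orthogonal i i j; rewrite ij /=.
- exact/lanczos_p_unit/b0.
Qed.

Lemma lanczos_Q_orthonormal k : (forall i, (i < k)%N -> al i.+1 != 0) ->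
  (lanczos_Q A b k)^T *m lanczos_Q A b k = 1%:M.
Proof.
move=> b0; apply/matrixP => i j; rewrite !mxE.
transitivity (dotv (q i.+1) (q j.+1)).
  by rewrite dotvE; apply: eq_bigr => r _; rewrite !mxE.
rewrite -val_eqE /=; have [ij|ij|->] := ltngtP i j.
- by have [|//] := @lanczos_orthogonal j j i; rewrite ij /=.
- by rewrite dotvC; have [|//] := @lanczos_orthogonal i i j; rewrite ij /=.
- exact/lanczos_q_unit/b0.
Qed.

Lemma col_lanczos_Q k (j : 'I_k) : col j (lanczos_Q A b k) = q j.+1.
Proof. by apply/colP => i; rewrite !mxE. Qed.

(** The vectors [A^T p_i] are carried along because the vectors [p_i] live in
    the other space, where the invariant property has no meaning. *)
Lemma lanczos_q_invariant (P : 'cV[R]_n -> Prop) :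
  P 0 -> (forall t u v, P u -> P v -> P (t *: u + v)) ->
  P (A^T *m b) -> (forall x, P x -> P (A^T *m A *m x)) ->
  forall i, P (q i) /\ P (A^T *m p i.+1).
Proof.
move=> P0 PL Pb PA; have PZ t u : P u -> P (t *: u).
  by move=> Pu; rewrite -[_ *: _]addr0; apply: PL.
have PB t u v : P u -> P v -> P (u - t *: v).
  by move=> Pu Pv; rewrite addrC -scaleNr; apply: PL.
elim=> [|i [Pq Pp]].
  by split; [exact: P0 | rewrite -[p 1]/(_ *: b) -scalemxAr; exact: PZ].
have Pq' : P (q i.+1) by rewrite lanczos_qS; apply/PZ/PB.
split=> //; rewrite lanczos_pS -scalemxAr mulmxBr -scalemxAr mulmxA.
by apply/PZ/PB => //; exact: PA.
Qed.

Lemma lanczos_alpha_neq0 j i : (i <= j)%N -> al j.+1 != 0 -> al i.+1 != 0.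
Proof.
elim: j => [|j IH]; first by rewrite leqn0 => /eqP->.
rewrite leq_eqVlt => /orP[/eqP->//|ij] aj; apply: IH => //.
by apply: contra_neq aj => /lanczos_alpha0_beta0; apply: lanczos_beta0_alpha0.
Qed.

(** If [A^T b] involves only the right singular vectors with index in [I], so
    do all the [q_j].  A nonzero coefficient at step #|I| + 1 would mean
    that there are #|I| + 1 orthonormal vectors in a space of dimension
    #|I|. *)
Lemma lanczos_stops (V : 'M[R]_n) (s : 'I_n -> R) (I : {set 'I_n}) :
  V^T *m V = 1%:M ->
  (forall i (x : 'cV[R]_n),
     (V^T *m (A^T *m A *m x)) i 0 = s i * (V^T *m x) i 0) ->
  (forall i, i \notin I -> (V^T *m (A^T *m b)) i 0 = 0) ->
  al #|I|.+1 = 0.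
Proof.
move=> VV eig bI; apply/eqP/negP => /negP aI.
have QQ : (lanczos_Q A b #|I|.+1)^T *m lanczos_Q A b #|I|.+1 = 1%:M.
  by apply: lanczos_Q_orthonormal => i iI; exact: lanczos_alpha_neq0 aI.
suff : (#|I|.+1 <= #|I|)%N by rewrite ltnn.
apply: (orthonormal_support (Z := V^T *m lanczos_Q A b #|I|.+1)).
  by rewrite trmx_mul trmxK -mulmxA (mulmxA V) (mulmx1C VV) mul1mx.
move=> i j iI.
have -> : (V^T *m lanczos_Q A b #|I|.+1) i j = (V^T *m q j.+1) i 0.
  by rewrite -col_lanczos_Q -col_mulmx [RHS]mxE.
have [|t u v||x|//] :=
  @lanczos_q_invariant (fun x => (V^T *m x) i 0 = 0) _ _ _ _ j.+1.
- by rewrite mulmx0 mxE.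
- move=> u0 v0; rewrite mulmxDr -scalemxAr mxE [X in X + _]mxE.
  by rewrite u0 v0 mulr0 addr0.
- exact: bI.
- by move=> x0; rewrite eig x0 mulr0.
Qed.

Lemma colspan_lanczos_Q k i : (i <= k)%N -> q i \in colspan (lanczos_Q A b k).
Proof.
case: i => [|i] ik; first exact: mem0v.
rewrite -(col_lanczos_Q (Ordinal ik)) memv_span //.
by rewrite (map_f (fun j => col j (lanczos_Q A b k))) ?mem_enum.
Qed.

(** [A^T A q_j] is a combination of [q_(j-1)], [q_j] and [q_(j+1)] by the
    recurrences, and [A^T b] is a multiple of [q_1]. *)
Lemma krylov_sub_lanczos k x :
  x \in krylov A b k -> x \in colspan (lanczos_Q A b k).
Proof.
have step l i y : (l < i)%N -> y \in colspan (lanczos_Q A b l) ->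
    A^T *m A *m y \in colspan (lanczos_Q A b i).
  move=> li; move: y; apply: span_ind.
  - by rewrite mulmx0 mem0v.
  - by move=> a u v Hu Hv; rewrite mulmxDr -scalemxAr memvD ?memvZ.
  - move=> _ /mapP[j _ ->]; rewrite col_lanczos_Q -mulmxA lanczos_recp.
    have jl : (j.+2 <= i)%N := leq_ltn_trans (ltn_ord j) li.
    rewrite mulmxDr -!scalemxAr !lanczos_recq.
    by rewrite !(memvD, memvZ) ?colspan_lanczos_Q // ltnW // ltnW.
have pow l i : (l < i)%N ->
    (A^T *m A) ^+ l *m (A^T *m b) \in colspan (lanczos_Q A b i).
  elim: l i => [|l IH] i li.
    rewrite expr0 mul1mx -[X in A^T *m X]lanczos_p1 -scalemxAr lanczos_recq.
    rewrite lanczos_q0 scaler0 addr0; do 2 apply: memvZ.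
    exact: colspan_lanczos_Q.
  rewrite exprS -[_ * _]/(_ *m _) -mulmxA.
  by apply: (step l.+1) => //; apply: IH.
move: x; apply: span_ind.
- exact: mem0v.
- by move=> a u v Hu Hv; rewrite memvD ?memvZ.
- by move=> _ /mapP[j jk ->]; apply: pow; rewrite mem_iota in jk.
Qed.

End Lanczos.

(** * Canonical angles *)

Section CanonicalAngles.
Variable R : realType.

Lemma spectral_norm_diag k (d : 'rV[R]_k) i :
  (forall j, `|d 0 j| <= `|d 0 i|) -> spectral_norm (diag_mx d) = `|d 0 i|.
Proof.
move=> di.
have entry (x : 'cV[R]_k) j : (diag_mx d *m x) j 0 = d 0 j * x j 0 :> R.
  by rewrite mul_diag_mx !mxE.
pose E := [set norm2 (diag_mx d *m x) | x in [set x | norm2 x = 1]]%classic.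
have ub : ubound E `|d 0 i|.
  move=> _ [x /norm2_eq1 x1 <-].
  rewrite -ler_sqr ?nnegrE ?norm2_ge0 // sqr_norm2 -[leRHS]mulr1 -x1.
  rewrite !dotv_sqr mulr_sumr; apply: ler_sum => j _.
  rewrite entry exprMn ler_wpM2r ?sqr_ge0 //.
  by rewrite -(real_normK (num_real (d 0 j))) ler_sqr ?nnegrE.
have att : E `|d 0 i|.
  exists (delta_mx i 0); first exact/norm2_eq1/dotv_delta.
  have -> : diag_mx d *m (delta_mx i 0 : 'cV_k) = d 0 i *: delta_mx i 0.
    apply/colP => j; rewrite entry !mxE; have [->|ji] := eqVneq j i => //.
    by rewrite !mulr0.
  apply/eqP; rewrite -(@eqrXn2 _ 2) ?norm2_ge0 // sqr_norm2 dotvZl dotvZr.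
  by rewrite dotv_delta mulr1 -expr2 real_normK // num_real.
apply/le_anti/andP; split; first by apply: ge_sup => //; exists `|d 0 i|.
by apply: ub_le_sup => //; exists `|d 0 i|.
Qed.

Variables (n k : nat) (W1 W2 : {vspace 'cV[R]_n}) (Theta : nat -> R).
Hypotheses (k0 : (0 < k)%N) (angles : canonical_angles k W1 W2 Theta).

(** The angles enter only through their cosines: the squared sines are largest
    where the cosines, which are sorted, are smallest. *)
Lemma spectral_norm_sin_diag :
  spectral_norm (sin_diag k Theta) ^+ 2 = 1 - cos (Theta k) ^+ 2.
Proof.
have sin2 x : sin x ^+ 2 = 1 - cos x ^+ 2 :> R.
  by rewrite -(cos2Dsin2 x) addrC addKr.
have [_ [X [Y [_ _ [U [V [_ _ _]]]]]]] := angles.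
rewrite minnn => c0 dec.
have kk : (k.-1 < k)%N by rewrite prednK.
rewrite (spectral_norm_diag (i := Ordinal kk)) => [|j].
  by rewrite mxE /= prednK // real_normK ?num_real.
rewrite -ler_sqr ?nnegrE // !real_normK ?num_real // !mxE /= prednK // !sin2.
have ck : 0 <= cos (Theta k) by apply: c0; rewrite k0 leqnn.
have cj : 0 <= cos (Theta j.+1) by apply: c0; rewrite ltn_ord.
rewrite lerD2l lerN2 ler_sqr ?nnegrE //.
by apply: (nonincreasing_from1 dec) => //; rewrite ltn_ord leqnn.
Qed.

Variables (F : 'M[R]_(n, k)).
Hypothesis F_basis : orthonormal_basis F W1.

Lemma dotv_proj l (X : 'M[R]_(n, l)) (x y : 'cV[R]_n) :
  dotv (X^T *m x) (X^T *m y) = dotv x (X *m X^T *m y).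
Proof. by rewrite dotv_adj trmxK mulmxA. Qed.

(** This lemma and the next one are the variational characterization of the
    smallest singular value, applied to [X^T Y] for the bases that come with
    the angles.  [X] can be exchanged for [F] because both give the same
    projector onto [W1]. *)
Lemma min_cos_le w : w \in W2 ->
  cos (Theta k) ^+ 2 * dotv w w <= dotv (F^T *m w) (F^T *m w).
Proof.
have [_ [X [Y [XW [YY YW] sv]]]] := angles.
rewrite -YW => /colspanP[c ->]; rewrite dotv_isometry //.
rewrite dotv_proj -(orthonormal_basis_proj XW F_basis) -dotv_proj mulmxA.
by rewrite -quad_form_dotv; apply: min_singular_value_le sv; rewrite k0 leqnn.
Qed.

Lemma min_cos_attained : exists2 w, w \in W2 /\ dotv w w = 1 &
  dotv (F^T *m w) (F^T *m w) = cos (Theta k) ^+ 2.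
Proof.
have [_ [X [Y [XW [YY YW] sv]]]] := angles.
have kk : (0 < k <= k)%N by rewrite k0 leqnn.
have [c c1 <-] := min_singular_value_attained kk sv.
exists (Y *m c).
  by rewrite dotv_isometry // -YW; split => //; apply/colspanP; exists c.
rewrite dotv_proj -(orthonormal_basis_proj XW F_basis) -dotv_proj mulmxA.
by rewrite quad_form_dotv.
Qed.

End CanonicalAngles.

Section Columns.
Variables (R : realType) (n k : nat) (hk : (k <= n)%N) (V : 'M[R]_n).
Hypothesis VV : V^T *m V = 1%:M.

Lemma first_cols_basis :
  orthonormal_basis (first_cols hk V) (colspan (first_cols hk V)).
Proof.
split=> //; apply/matrixP => i j; rewrite mxE.
have := congr1 (fun M : 'M[R]_n => M (widen_ord hk i) (widen_ord hk j)) VV.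
by rewrite !mxE => <-; apply: eq_bigr => l _; rewrite !mxE.
Qed.

Lemma dotv_first_cols x y :
  dotv ((first_cols hk V)^T *m x) ((first_cols hk V)^T *m y)
  = \sum_(i < n | (i < k)%N) (V^T *m x) i 0 * (V^T *m y) i 0.
Proof.
have E z i : ((first_cols hk V)^T *m z) i 0 = (V^T *m z) (widen_ord hk i) 0.
  by rewrite !mxE; apply: eq_bigr => l _; rewrite !mxE.
by rewrite big_ord_narrow dotvE; apply: eq_bigr => i _; rewrite !E.
Qed.

Lemma dotv_last_cols x y :
  dotv ((last_cols hk V)^T *m x) ((last_cols hk V)^T *m y)
  = dotv x y - dotv ((first_cols hk V)^T *m x) ((first_cols hk V)^T *m y).
Proof.
have VV' : V^T^T *m V^T = 1%:M by rewrite trmxK (mulmx1C VV).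
rewrite -(dotv_isometry _ _ VV') dotv_first_cols !dotvE.
set f := fun i : 'I_n => (V^T *m x) i 0 * (V^T *m y) i 0.
rewrite -/(\sum_i f i) -/(\sum_(i < n | (i < k)%N) f i).
have -> : \sum_i f i = \sum_(i < k + (n - k)) f (cast_ord (subnKC hk) i).
  rewrite (reindex (cast_ord (subnKC hk))) //.
  by exists (cast_ord (esym (subnKC hk))) => i _;
    rewrite (cast_ordK, cast_ordKV).
rewrite big_split_ord big_ord_narrow /=.
have -> : \sum_(i < k) f (cast_ord (subnKC hk) (lshift (n - k) i))
    = \sum_(i < k) f (widen_ord hk i).
  by apply: eq_bigr => i _; congr f; apply: val_inj.
rewrite [RHS]addrC addKr; apply: eq_bigr => i _.
have E z : ((last_cols hk V)^T *m z) i 0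
    = (V^T *m z) (cast_ord (subnKC hk) (rshift k i)) 0.
  by rewrite !mxE; apply: eq_bigr => l _; rewrite !mxE.
by rewrite !E.
Qed.

End Columns.

(** * Weighted sums over two clusters *)

Section TwoClusters.
Variable R : realType.

(** Replacing every weight [s i] by the least weight of its cluster, [s a] for
    the indices below [k] and [s c] for the others, can only decrease the sum.
    Nothing is lost only if no mass sits outside of [a] and [c]; the flag [C]
    records a consequence of this case. *)
Lemma two_cluster_bound n k (s y : 'I_n -> R) (a c : 'I_n) e (C : bool) :
  (forall i : 'I_n, (i < k)%N -> i != a -> s a < s i) ->
  (forall i : 'I_n, (k <= i)%N -> i != c -> s c < s i) ->
  \sum_(i < n | (i < k)%N) y i ^+ 2 = e -> \sum_i y i ^+ 2 = 1 ->
  ((forall i, i != a -> i != c -> y i = 0) -> C) ->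
  e * s a + (1 - e) * s c < \sum_i s i * y i ^+ 2 ?<= if C.
Proof.
move=> sa sc ye y1 yC.
pose g (i : 'I_n) := (s i - (if (i < k)%N then s a else s c)) * y i ^+ 2.
have g0 i : 0 <= g i.
  rewrite mulr_ge0 ?sqr_ge0 // subr_ge0; case: ltnP => ik.
    by have [->//|ia] := eqVneq i a; apply/ltW/sa.
  by have [->//|ic] := eqVneq i c; apply/ltW/sc.
have gE : \sum_i s i * y i ^+ 2 = e * s a + (1 - e) * s c + \sum_i g i.
  have tail : \sum_(i < n | ~~ (i < k)%N) y i ^+ 2 = 1 - e.
    have := y1; rewrite (bigID (fun i : 'I_n => (i < k)%N)) /= ye; lra.
  rewrite -tail -ye !mulr_suml.
  have -> : forall A B : R, A + B + \sum_i g i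
     = (A + \sum_(i < n | (i < k)%N) g i)
     + (B + \sum_(i < n | ~~ (i < k)%N) g i).
    move=> A B; rewrite [in LHS](bigID (fun i : 'I_n => (i < k)%N)) /=.
    exact: addrACA.
  rewrite (bigID (fun i : 'I_n => (i < k)%N)) /= -!big_split /=.
  by congr (_ + _); apply: eq_bigr => i ik; rewrite /g ?ik ?(negPf ik); ring.
rewrite gE; case: (boolP C) => [_|nC] /=.
  by rewrite lerDl sumr_ge0.
rewrite ltrDl lt_neqAle sumr_ge0 // andbT eq_sym.
apply: contra nC; rewrite psumr_eq0 // => /allP gi; apply: yC => i ia ic.
have := gi i (mem_index_enum i); rewrite /= mulf_eq0 sqrf_eq0 => /orP[|/eqP//].
rewrite subr_eq0; case: ltnP => ik /eqP E.
  by have := sa i ik ia; rewrite E ltxx.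
by have := sc i ik ic; rewrite E ltxx.
Qed.

End TwoClusters.

(** * The minimizer and its stationarity *)

Section Stationarity.
Variables (R : realType) (n l : nat) (W : {vspace 'cV[R]_n}).
Variables (F : 'M[R]_(n, l)) (e : R) (q : 'cV[R]_n).

(** First-order condition for a minimizer [q] of the Rayleigh quotient of
    [F F^T] on [W]: the quadratic form [|F^T w|^2 - e |w|^2] is nonnegative on
    [W] and vanishes at [q], so its polar form vanishes at [q] as well. *)
Lemma stationary :
  (forall w, w \in W -> e * dotv w w <= dotv (F^T *m w) (F^T *m w)) ->
  q \in W -> dotv (F^T *m q) (F^T *m q) = e * dotv q q ->
  forall w, w \in W -> dotv (F^T *m q) (F^T *m w) = e * dotv q w.
Proof.
move=> Fe Wq qe w Ww.
pose B := dotv (F^T *m q) (F^T *m w) - e * dotv q w.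
pose h := dotv (F^T *m w) (F^T *m w) - e * dotv w w.
have h0 : 0 <= h by rewrite subr_ge0 Fe.
have quad t : 0 <= t * (2 * B + t * h).
  have := Fe (q + t *: w); rewrite memvD ?memvZ // => /(_ isT).
  rewrite mulmxDr -scalemxAr !dotvDl !dotvDr !dotvZl !dotvZr qe.
  rewrite (dotvC w) (dotvC (F^T *m w) (F^T *m q)) /B /h; lra.
(* The minimizer of [t |-> 2 t B + t^2 h] is [- B / h]; adding 1 keeps the
   denominator away from 0 and the value is still negative unless [B = 0]. *)
have := quad (- B / (h + 1)).
have h1 : h + 1 != 0 by lra.
have -> : - B / (h + 1) * (2 * B + - B / (h + 1) * h)
   = - (B ^+ 2 * ((h + 2) / (h + 1) ^+ 2)) by field.
rewrite oppr_ge0 => hB.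
have : B ^+ 2 * ((h + 2) / (h + 1) ^+ 2) = 0.
  apply/le_anti; rewrite hB /= mulr_ge0 ?sqr_ge0 // divr_ge0 ?sqr_ge0 //; lra.
move/eqP; rewrite mulf_eq0 sqrf_eq0 => /orP[|].
  by rewrite subr_eq0 => /eqP.
rewrite mulf_eq0 invr_eq0 expf_eq0 /= (negPf h1) orbF => /eqP; lra.
Qed.

End Stationarity.

(** * Two-term minimizers in a Krylov space *)

Section Terminal.
Variables (R : realType) (m n : nat) (A : 'M[R]_(m, n)) (b : 'cV[R]_m).
Variables (V : 'M[R]_n) (D : 'I_n -> R).
Hypothesis VV : V^T *m V = 1%:M.
Hypothesis eig : forall i (x : 'cV[R]_n),
  (V^T *m (A^T *m A *m x)) i 0 = D i * (V^T *m x) i 0.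

Lemma krylov_coord0 k i x :
  (V^T *m (A^T *m b)) i 0 = 0 -> x \in krylov A b k -> (V^T *m x) i 0 = 0.
Proof.
move=> g0; move: x; apply: span_ind.
- by rewrite mulmx0 mxE.
- move=> t u v u0 v0; rewrite mulmxDr -scalemxAr mxE [X in X + _]mxE.
  by rewrite u0 v0 mulr0 addr0.
move=> _ /mapP[j _ ->]; elim: j => [|j IH]; first by rewrite expr0 mul1mx.
by rewrite exprS -[_ * _]/(_ *m _) -(mulmxA (A^T *m A)) eig IH mulr0.
Qed.

Lemma krylov_mem k j : (j < k)%N ->
  (A^T *m A) ^+ j *m (A^T *m b) \in krylov A b k.
Proof.
move=> jk; apply: memv_span.
by rewrite (map_f (fun j => (A^T *m A) ^+ j *m (A^T *m b))) // mem_iota.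
Qed.

(** Stationarity of a [q] supported on [a] and [c], tested against [A^T b] and
    against [A^T A A^T b], gives two linear equations that differ by the
    factors [D a] and [D c].  As these are distinct, [A^T b] has no component
    along the singular vector [a]; then no vector of the Krylov space has
    one, not even [q].  The second test vector exists only for [k >= 2].  For
    [k = 1], [q] is proportional to [A^T b], which therefore lies in the span
    of two singular vectors, and the recurrence stops after two steps. *)
Lemma two_sparse_minimizer_terminal k (a c : 'I_n) e q :
  (0 < k)%N -> (a < k <= c)%N -> D a != D c -> e != 1 ->
  q \in krylov A b k ->
  (forall w, w \in krylov A b k ->
     \sum_(i < n | (i < k)%N) (V^T *m q) i 0 * (V^T *m w) i 0
     = e * \sum_i (V^T *m q) i 0 * (V^T *m w) i 0) ->
  (forall i, i != a -> i != c -> (V^T *m q) i 0 = 0) ->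
  (V^T *m q) a 0 != 0 ->
  terminal_first_step A b k.
Proof.
move=> k0 /andP[ak kc] Dac e1 Wq stat supp ya0; rewrite /terminal_first_step.
have ac : a != c by apply: contraL (ak) => /eqP->; rewrite -leqNgt.
have [k1|k1] := eqVneq k 1%N; rewrite /=.
  move: Wq; rewrite k1 /krylov /= expr0 mul1mx span_seq1 => /vlineP[t qt].
  have yE i : (V^T *m q) i 0 = t * (V^T *m (A^T *m b)) i 0.
    by rewrite qt -scalemxAr mxE.
  have t0 : t != 0 by apply: contra_neq ya0 => t0; rewrite yE t0 mul0r.
  have := lanczos_stops (I := [set a; c]) VV eig.
  rewrite cards2 ac => -> // i; rewrite !inE negb_or => /andP[ia ic].
  by apply: (mulfI t0); rewrite mulr0 -yE supp.
have {}k1 : (1 < k)%N by rewrite ltn_neqAle eq_sym k1.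
pose y i := (V^T *m q) i 0.
have two w : w \in krylov A b k ->
    (1 - e) * (y a * (V^T *m w) a 0) = e * (y c * (V^T *m w) c 0).
  move=> /stat; rewrite (bigD1 a) //= big1 ?addr0; last first.
    move=> i /andP[ik ia]; rewrite supp ?mul0r //.
    by apply: contraL ik => /eqP ->; rewrite -leqNgt.
  rewrite (bigD1 a) //= (bigD1 c) 1?eq_sym //= big1 ?addr0 => [|i /andP[ia ic]].
    by rewrite -/(y a) -/(y c) => h; lra.
  by rewrite supp ?mul0r.
(* Test against the first two vectors of the Krylov sequence. *)
have := two _ (krylov_mem k0); have := two _ (krylov_mem k1).
rewrite expr0 mul1mx expr1 !eig; set ga := (_ *m _) a 0; set gc := (_ *m _) c 0.
move=> h1 h0; have : (D a - D c) * ((1 - e) * (y a * ga)) = 0.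
  have -> : (D a - D c) * ((1 - e) * (y a * ga))
    = (1 - e) * (y a * (D a * ga)) - D c * ((1 - e) * (y a * ga)) by ring.
  by rewrite h1 h0; ring.
move/eqP; rewrite !mulf_eq0 !subr_eq0 (negPf Dac) eq_sym (negPf e1) (negPf ya0).
by move=> /eqP ga0; rewrite (krylov_coord0 ga0 Wq) eqxx in ya0.
Qed.

End Terminal.

(** * The estimates *)

Lemma lteif_sqr (R : realType) (x y : R) C : 0 <= x -> 0 <= y ->
  x ^+ 2 < y ^+ 2 ?<= if C -> x < y ?<= if C.
Proof. by case: C => x0 y0; rewrite /= ?ler_sqr ?ltr_sqr. Qed.

Theorem theorem5p1 (R : realType) (m n : nat) (hmn : (n <= m)%N)
    (A : 'M[R]_(m, n)) (U : 'M[R]_m) (sigma : nat -> R) (V : 'M[R]_n)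
    (hsvd : is_svd A U sigma V)
    (hsigma_decr : forall i, (0 < i < n)%N -> sigma i.+1 < sigma i)
    (hsigma_pos : 0 < sigma n)
    (b : 'cV[R]_m)
    (k : nat) (hk0 : (0 < k)%N) (hkn : (k < n)%N)
    (hlanczos : no_breakdown A b k)
    (Theta : nat -> R)
    (hTheta : canonical_angles k (colspan (first_cols (ltnW hkn) V))
                               (krylov A b k) Theta)
    (eps : R) (heps : 0 < eps < 1)
    (hsin : spectral_norm (sin_diag k Theta) ^+ 2 = 1 - eps ^+ 2)
    (q : 'cV[R]_n)
    (hq : closest_unit_vector (krylov A b k) (last_cols (ltnW hkn) V) q)
    (theta : nat -> R) (htheta : ritz_values A b k theta) :
  [/\ eps ^+ 2 * sigma k ^+ 2 + (1 - eps ^+ 2) * sigma n ^+ 2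
        < quad_form A q ?<= if terminal_first_step A b k,
      quad_form A q
        < eps ^+ 2 * sigma 1%N ^+ 2 + (1 - eps ^+ 2) * sigma k.+1 ^+ 2
        ?<= if terminal_first_step A b k,
      sigma k.+1 / sigma k <= eps ->
        sigma k.+1 < Num.sqrt (quad_form A q)
    & forall delta : R, 0 < delta ->
        eps ^+ 2 <= delta / ((sigma 1%N / sigma k.+1) ^+ 2 - 1) ->
        theta k < Num.sqrt (1 + delta) * sigma k.+1
          ?<= if terminal_first_step A b k].
Proof.
have [_ VV _ _ _] := hsvd; have VV' : V^T^T *m V^T = 1%:M.
  by rewrite trmxK (mulmx1C VV).
have [e0 e1] := andP heps.
have ee0 : 0 < eps ^+ 2 by rewrite exprn_gt0.
have ee1 : eps ^+ 2 < 1 by rewrite expr_lt1 // ltW.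
have spos i : (0 < i <= n)%N -> 0 < sigma i.
  move=> /andP[i0]; rewrite leq_eqVlt => /orP[/eqP->//|ni].
  apply: lt_trans hsigma_pos (decreasing_from1 hsigma_decr i0 _).
  by rewrite ni /=.
have sdec i j : (0 < i)%N -> (i < j <= n)%N -> sigma j ^+ 2 < sigma i ^+ 2.
  move=> i0 /andP[ij jn]; have hin := leq_trans (ltnW ij) jn.
  rewrite ltr_sqr ?nnegrE ?ltW ?spos ?i0 ?hin ?jn ?(ltn_trans i0) //.
  by apply: (decreasing_from1 hsigma_decr); rewrite ?ij.
have F_basis := first_cols_basis (ltnW hkn) VV.
have cosk : cos (Theta k) ^+ 2 = eps ^+ 2.
  by have := spectral_norm_sin_diag hk0 hTheta; rewrite hsin; lra.
have := min_cos_le hk0 hTheta F_basis.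
have := min_cos_attained hk0 hTheta F_basis.
rewrite cosk => -[w0 [Ww0 w01] w0e] headW.
have [Wq /norm2_eq1 q1 qmax] := hq.
have headq : dotv ((first_cols (ltnW hkn) V)^T *m q)
    ((first_cols (ltnW hkn) V)^T *m q) = eps ^+ 2.
  have := qmax w0 Ww0 ((norm2_eq1 w0).2 w01).
  rewrite -ler_sqr ?nnegrE ?norm2_ge0 // !sqr_norm2 !(dotv_last_cols _ VV).
  by have := headW _ Wq; rewrite w0e w01 q1; lra.
have stat w : w \in krylov A b k ->
    \sum_(i < n | (i < k)%N) (V^T *m q) i 0 * (V^T *m w) i 0
    = eps ^+ 2 * \sum_i (V^T *m q) i 0 * (V^T *m w) i 0.
  move=> Ww; rewrite -(dotv_first_cols (ltnW hkn)) -dotvE.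
  rewrite (dotv_isometry _ _ VV').
  by apply: stationary Ww => //; rewrite headq q1 mulr1.
pose y i := (V^T *m q) i 0.
have y1 : \sum_i y i ^+ 2 = 1 by rewrite -q1 -(dotv_isometry _ _ VV') dotv_sqr.
have ye : \sum_(i < n | (i < k)%N) y i ^+ 2 = eps ^+ 2.
  by rewrite -headq dotv_first_cols; apply: eq_bigr => i _; rewrite expr2.
(* Equality in either estimate forces [y] to be supported on two indices. *)
have terminal (a c : 'I_n) : (a < k <= c)%N ->
    (forall i, i != a -> i != c -> y i = 0) -> terminal_first_step A b k.
  move=> akc supp; have [ak kc] := andP akc.
  apply: (two_sparse_minimizer_terminal VV
    (D := fun i => sigma i.+1 ^+ 2) _ hk0 akc _ _ Wq stat supp).
  - by move=> i x; apply: svd_gram hsvd.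
  - by rewrite gt_eqF // sdec // ltnS (leq_trans ak kc) ltn_ord.
  - by rewrite lt_eqF.
  rewrite -sqrf_eq0 -/(y a); move: ye; rewrite (bigD1 a) //= big1 ?addr0.
    by move=> ->; rewrite gt_eqF.
  move=> i /andP[ik ia]; rewrite supp ?expr0n //.
  by apply: contraL ik => /eqP ->; rewrite -leqNgt.
have qE : quad_form A q = \sum_(i < n) sigma i.+1 ^+ 2 * y i ^+ 2.
  exact: svd_quad_form hsvd.
have n0 : (0 < n)%N := leq_ltn_trans (leq0n k) hkn.
have lower : eps ^+ 2 * sigma k ^+ 2 + (1 - eps ^+ 2) * sigma n ^+ 2
    < quad_form A q ?<= if terminal_first_step A b k.
  have an : (k.-1 < n)%N by rewrite (leq_ltn_trans (leq_pred k)).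
  have cn : (n.-1 < n)%N by rewrite prednK.
  have := @two_cluster_bound R n k (fun i => sigma i.+1 ^+ 2) y
    (Ordinal an) (Ordinal cn) (eps ^+ 2) (terminal_first_step A b k).
  rewrite /= !prednK // -qE; apply=> //.
  - move=> i ik ia; apply: sdec => //; rewrite (ltnW hkn) andbT.
    by rewrite ltn_neqAle ik andbT -(prednK hk0) eqSS.
  - move=> i ik ia; apply: sdec => //; rewrite leqnn andbT.
    by rewrite ltn_neqAle ltn_ord andbT -[X in _ != X](prednK n0) eqSS.
  - by apply: terminal; rewrite /= prednK // leqnn -ltnS prednK.
have upper : quad_form A q
    < eps ^+ 2 * sigma 1%N ^+ 2 + (1 - eps ^+ 2) * sigma k.+1 ^+ 2
    ?<= if terminal_first_step A b k.
  (* Negating the weights turns the greatest weights into the least ones. *)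
  have := @two_cluster_bound R n k (fun i => - sigma i.+1 ^+ 2) y
    (Ordinal n0) (Ordinal hkn) (eps ^+ 2) (terminal_first_step A b k).
  have -> : \sum_i - sigma (nat_of_ord i).+1 ^+ 2 * y i ^+ 2 = - quad_form A q.
    by rewrite qE -sumrN; apply: eq_bigr => i _; rewrite mulNr.
  rewrite /= !mulrN -opprD lteifN2; apply=> //.
  - move=> i ik i0; rewrite ltrN2; apply: sdec => //.
    by rewrite !ltnS ltn_ord andbT lt0n.
  - move=> i ik ic; rewrite ltrN2; apply: sdec => //.
    by rewrite !ltnS ltn_ord andbT ltn_neqAle eq_sym ic.
  - by apply: terminal; rewrite /= hk0 leqnn.
have sk0 : 0 < sigma k by apply: spos; rewrite hk0 ltnW.
have sk1 : 0 < sigma k.+1 by apply: spos.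
split=> //.
  rewrite ler_pdivrMr // => hsk.
  have quad : sigma k.+1 ^+ 2 < quad_form A q.
    have : eps ^+ 2 * sigma k ^+ 2 + (1 - eps ^+ 2) * sigma n ^+ 2
      <= quad_form A q by apply: lteifW lower.
    have : sigma k.+1 ^+ 2 <= eps ^+ 2 * sigma k ^+ 2.
      by rewrite -exprMn ler_sqr // nnegrE ltW // mulr_gt0.
    have : 0 < (1 - eps ^+ 2) * sigma n ^+ 2.
      by rewrite mulr_gt0 ?subr_gt0 ?exprn_gt0.
    lra.
  rewrite -[ltLHS]ger0_norm ?ltW // -sqrtr_sqr ltr_sqrt //.
  by apply: lt_trans quad; rewrite exprn_gt0.
move=> delta d0 hd.
(* [q = Q_k x] with [x] a unit vector, and [|B_k x| <= |A q|] because the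
   columns of [P_(k+1)] are orthonormal. *)
have [x qx] := (colspanP _ _).1 (krylov_sub_lanczos Wq).
have al0 i : (i < k)%N -> lanczos_alpha A b i.+1 != 0.
  by move=> ik; have [a0 _] := hlanczos i.+1 ik; rewrite gt_eqF.
have be0 i : (i < k.+1)%N -> lanczos_beta A b i.+1 != 0.
  case: i => [_|i ik]; last by have [_ b0] := hlanczos i.+1 ik; rewrite gt_eqF.
  by apply: contra_neq (al0 0 hk0); apply: lanczos_beta0_alpha0.
have x1 : dotv x x = 1.
  by rewrite -(dotv_isometry _ _ (lanczos_Q_orthonormal al0)) -qx.
have ritz : theta k ^+ 2 <= quad_form A q.
  have kk : (0 < k <= k.+1)%N by rewrite hk0 leqnSn.
  have := min_singular_value_le x kk htheta.
  rewrite x1 mulr1 => /le_trans; apply; rewrite !quad_form_dotv /lanczos_B.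
  rewrite -!mulmxA -qx; exact: bessel (lanczos_P_orthonormal be0).
have th0 : 0 <= theta k.
  have [U' [V' [_ _ _ t0 _]]] := htheta; apply: t0.
  by rewrite hk0 (minn_idPr (leqnSn k)) leqnn.
apply: lteif_sqr => //; first by rewrite mulr_ge0 ?sqrtr_ge0 ?ltW.
rewrite exprMn sqr_sqrtr; last by lra.
have target : eps ^+ 2 * sigma 1%N ^+ 2 + (1 - eps ^+ 2) * sigma k.+1 ^+ 2
    <= (1 + delta) * sigma k.+1 ^+ 2.
  have r1 : 0 < (sigma 1%N / sigma k.+1) ^+ 2 - 1.
    rewrite subr_gt0 expr_div_n ltr_pdivlMr ?exprn_gt0 // mul1r.
    by apply: sdec => //; rewrite ltnS hk0.
  move: hd; rewrite ler_pdivlMr // => hd.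
  have -> : eps ^+ 2 * sigma 1%N ^+ 2 + (1 - eps ^+ 2) * sigma k.+1 ^+ 2
    = (1 + eps ^+ 2 * ((sigma 1%N / sigma k.+1) ^+ 2 - 1)) * sigma k.+1 ^+ 2.
    by field; rewrite gt_eqF.
  by rewrite ler_pM2r ?exprn_gt0 // lerD2l.
by move: upper; case: (terminal_first_step A b k) => /= upper; lra.
Qed.
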